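(* Let $(\mathcal G,\bullet)$ be a left unital associative semiloopoid over $\Lambda=\Lambda_{\mathrm{in}}\sqcup\Lambda_{\mathrm{un}}$, with source and target maps $\mathfrak s,\mathfrak t\colon\mathcal G\to\Lambda$. The following data are equivalent: (i) a quiver-theoretic skew brace structure on $\mathcal G$; (ii) a post-semiloopoid $(\mathfrak s\colon\mathcal G\to\Lambda,\{\cdot_\lambda\}_{\lambda\in\Lambda},\{\mathbf 1_\lambda\}_{\lambda\in\Lambda},\mathfrak t,\triangleright)$ such that $x\bullet y=x\cdot_{\mathfrak s(x)}(x\triangleright y)$ for all $x,y\in\mathcal G$ with $\mathfrak t(x)=\mathfrak s(y)$.
   Context: A quiver over a nonempty set $\Lambda$ is a nonempty set $\mathcal G$ with maps $\mathfrak s,\mathfrak t\colon\mathcal G\to\Lambda$ (source, target) such that $\Lambda=\operatorname{im}\mathfrak s\cup\operatorname{im}\mathfrak t$; $\mathcal G(\lambda,\Lambda)$, resp. $\mathcal G(\Lambda,\lambda)$, is the set of arrows with source, resp. target, $\lambda$. Left unital associative semiloopoid over $\Lambda$: a quiver $\mathcal G$ with an associative partial operation $\bullet$, where $x\bullet y$ is defined exactly when $\mathfrak t(x)=\mathfrak s(y)$ and has source $\mathfrak s(x)$ and target $\mathfrak t(y)$, such that $x\bullet(\,\cdot\,)\colon\mathcal G(\mathfrak t(x),\Lambda)\to\mathcal G(\mathfrak s(x),\Lambda)$ is bijective for all $x$, and such that for all $\lambda\in\operatorname{im}\mathfrak t$ there is a loop $\mathbf 1_\lambda$ on $\lambda$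 with $x\bullet\mathbf 1_\lambda=x$ and $\mathbf 1_\lambda\bullet y=y$ for all $x\in\mathcal G(\Lambda,\lambda)$, $y\in\mathcal G(\lambda,\Lambda)$. One sets $\Lambda_{\mathrm{un}}=\operatorname{im}\mathfrak t$ and $\Lambda_{\mathrm{in}}=\Lambda\smallsetminus\Lambda_{\mathrm{un}}$. Quiver-theoretic skew brace structure on $(\mathcal G,\bullet)$: a group operation $\cdot_\lambda$ on $\mathcal G(\lambda,\Lambda)$ for all $\lambda\in\Lambda$, such that $x\bullet(y\cdot_{\mathfrak t(x)}z)=(x\bullet y)\cdot_{\mathfrak s(x)}x^{-1}\cdot_{\mathfrak s(x)}(x\bullet z)$ whenever $\mathfrak t(x)=\mathfrak s(y)=\mathfrak s(z)$, where $x^{-1}$ is the inverse of $x$ in $(\mathcal G(\mathfrak s(x),\Lambda),\cdot_{\mathfrak s(x)})$. (This implies that $\mathbf 1_\lambda$ is the unit of $\cdot_\lambda$ for $\lambda\in\Lambda_{\mathrm{un}}$; for the other $\lambda$, in (ii), $\mathbf 1_\lambda$ denotes the unit of the group $(\mathcal G(\lambda,\Lambda),\cdot_\lambda)$.) Group bundle over $\Lambda$: a map $p\colon\mathcal G\to\Lambda$ with a group structure $(\mathcal G_\lambda,\cdot_\lambda,1_\lambda)$ on each fibre $\mathcal G_\lambda=p^{-1}(\lambda)$, $\lambda\in\Lambda$, such that all the groups $\mathcal G_\lambda$ are pairwise isomorphic. Post-semiloopoid over $\Lambda$: a datum $(p\colon\mathcal G\to\Lambda,\{\cdot_\lambda\}_{\lambda\in\Lambda},\{1_\lambda\}_{\lambda\in\Lambda},\Phi,\triangleright)$,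 where $p\colon\mathcal G\to\Lambda$ is a group bundle with group structures $(\mathcal G_\lambda,\cdot_\lambda,1_\lambda)$; $\Phi\colon\mathcal G\to\Lambda$ is a map; and $\triangleright\colon\{(g,h)\in\mathcal G\times\mathcal G:\Phi(g)=p(h)\}\to\mathcal G$ is a map, satisfying: (1) $\Phi(1_\lambda)=\lambda$ for all $\lambda\in\operatorname{im}\Phi$; (2) $p(g\triangleright h)=p(g)$ for all $g\in\mathcal G$, $h\in\mathcal G_{\Phi(g)}$; (3) $\Phi(g\cdot_{p(g)}(g\triangleright h))=\Phi(h)$ for all $g\in\mathcal G$, $h\in\mathcal G_{\Phi(g)}$; (4) $g\triangleright(h\cdot_{\Phi(g)}k)=(g\triangleright h)\cdot_{p(g)}(g\triangleright k)$ for all $g\in\mathcal G$, $h,k\in\mathcal G_{\Phi(g)}$; (5) $g\triangleright(h\triangleright k)=(g\cdot_{p(g)}(g\triangleright h))\triangleright k$ for all $g\in\mathcal G$, $h\in\mathcal G_{\Phi(g)}$, $k\in\mathcal G_{\Phi(h)}$; (6) $g\triangleright(\,\cdot\,)\colon\mathcal G_{\Phi(g)}\to\mathcal G_{p(g)}$ is bijective for all $g\in\mathcal G$.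
   Formalization: False for disconnected quivers, as group bundles need pairwise isomorphic groups (Z/2 and Z/3 as loops on two vertices). Proved: as stated for connected quivers; in general, (ii) matches those (i) with pairwise isomorphic groups, and (i) matches (ii) without the isomorphism clause. *)

(* Defs.v *)
From mathcomp Require Import ssreflect ssrfun ssrbool.
From Stdlib Require Import Relations.

Definition fibre {G L : Type} (p : G -> L) (l : L) : Type := {x : G | p x = l}.

Definition to_fibre {G L : Type} {p : G -> L} {l : L} (x : G) (e : p x = l) :
  fibre p l := exist (fun x => p x = l) x e.

Definition in_own_fibre {G L : Type} (p : G -> L) (x : G) : fibre p (p x) :=
  to_fibre x erefl.

(* MathComp's groupType also carries a choice operator on its carrier, which is
   not part of the data of a group. *)
Record group_on (T : Type) : Type := GroupOn {
  gmul : T -> T -> T;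
  gone : T;
  ginv : T -> T;
  gmulA : associative gmul;
  gmul1x : left_id gone gmul;
  gmulx1 : right_id gone gmul;
  gmulVx : left_inverse gone ginv gmul;
  gmulxV : right_inverse gone ginv gmul
}.
Arguments gmul {T}.
Arguments gone {T}.
Arguments ginv {T}.

Definition isomorphic {T U : Type} (A : group_on T) (B : group_on U) : Prop :=
  exists2 phi : T -> U,
    bijective phi & {morph phi : x y / gmul A x y >-> gmul B x y}.

Definition fibre_groups {G L : Type} (p : G -> L) : Type :=
  forall l : L, group_on (fibre p l).

Definition pairwise_isomorphic {G L : Type} {p : G -> L}
    (B : fibre_groups p) : Prop :=
  forall l m : L, isomorphic (B l) (B m).

Record group_bundle {G L : Type} (p : G -> L) : Type := GroupBundle {
  gb_groups : fibre_groups p;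
  gb_iso : pairwise_isomorphic gb_groups
}.
Arguments gb_groups {G L p}.
Arguments gb_iso {G L p}.

(* Nonemptiness of L follows from that of the set of arrows. *)
Record quiver (L : Type) : Type := Quiver {
  arrow :> Type;
  src : arrow -> L;
  tgt : arrow -> L;
  arrow_inhabited : inhabited arrow;
  vertex_covered :
    forall l : L, (exists x, src x = l) \/ (exists x, tgt x = l)
}.
Arguments src {L q}.
Arguments tgt {L q}.

Definition connected {L : Type} (Q : quiver L) : Prop :=
  forall l m : L,
    clos_refl_sym_trans L
      (fun a b => exists2 x : Q, src x = a & tgt x = b) l m.

(* A partial operation defined on the pairs (x, y) with f x = p y; it takes the
   proof of this as an argument.  The equation is oriented so that it says that
   y lies in the fibre of p over f x. *)
Definition partial_op {G L : Type} (p f : G -> L) : Type :=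
  forall x y : G, p y = f x -> G.

(* The map op x (.) between fibres of p. *)
Definition left_translation {G L : Type} {p f : G -> L} {op : partial_op p f}
    (op_p : forall x y e, p (op x y e) = p x) (x : G) (y : fibre p (f x)) :
  fibre p (p x) := to_fibre (op x (sval y) (svalP y)) (op_p _ _ _).

Definition unit_loop {L : Type} {Q : quiver L} (op : partial_op src tgt)
    (l : L) (u : Q) : Prop :=
  [/\ src u = l, tgt u = l,
      forall x (e : src u = tgt x), tgt x = l -> op x u e = x
    & forall y (e : src y = tgt u), src y = l -> op u y e = y].

Record semiloopoid (L : Type) : Type := Semiloopoid {
  sl_quiver :> quiver L;
  bullet : partial_op (@src L sl_quiver) tgt;
  src_bullet : forall x y e, src (bullet x y e) = src x;
  tgt_bullet : forall x y e, tgt (bullet x y e) = tgt y;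
  bulletA : forall (x y z : sl_quiver)
      (xy : src y = tgt x) (yz : src z = tgt y)
      (x_yz : src (bullet y z yz) = tgt x)
      (xy_z : src z = tgt (bullet x y xy)),
    bullet x (bullet y z yz) x_yz = bullet (bullet x y xy) z xy_z;
  bullet_bij : forall x : sl_quiver, bijective (left_translation src_bullet x);
  bullet_unit : forall l : L, (exists x : sl_quiver, tgt x = l) ->
    exists u : sl_quiver, unit_loop bullet l u
}.
Arguments bullet {L s}.
Arguments src_bullet {L s}.
Arguments tgt_bullet {L s}.

Record skew_brace {L : Type} (G : semiloopoid L) : Type := SkewBrace {
  sb_groups : fibre_groups (@src L G);
  sb_distr : forall (x : G) (y z : fibre src (tgt x)),
    let mul := gmul (sb_groups (src x)) in
    let inv := ginv (sb_groups (src x)) in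
    let x_bullet := left_translation src_bullet x in
    x_bullet (gmul (sb_groups (tgt x)) y z) =
    mul (mul (x_bullet y) (inv (in_own_fibre src x))) (x_bullet z)
}.
Arguments sb_groups {L G}.

(* The arrow g . (g |> h), the product being taken in the fibre of g. *)
Definition mul_op {G L : Type} {p f : G -> L} (B : fibre_groups p)
    {op : partial_op p f} (op_p : forall g h e, p (op g h e) = p g)
    (g h : G) (e : p h = f g) : G :=
  sval (gmul (B (p g)) (in_own_fibre p g) (to_fibre (op g h e) (op_p g h e))).

(* The data and axioms of a post-semiloopoid over a family of groups on the
   fibres of p, without the requirement that these groups are isomorphic. *)
Record post_structure {G L : Type} {p : G -> L} (Phi : G -> L)
    (B : fibre_groups p) : Type := PostStructure {
  tri : partial_op p Phi;
  Phi_one : forall l : L, (exists g, Phi g = l) -> Phi (sval (gone (B l))) = l;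
  p_tri : forall g h e, p (tri g h e) = p g;
  Phi_mul_tri : forall g h e, Phi (mul_op B p_tri g h e) = Phi h;
  tri_mul : forall (g : G) (h k : fibre p (Phi g)),
    let g_tri := left_translation p_tri g in
    g_tri (gmul (B (Phi g)) h k) = gmul (B (p g)) (g_tri h) (g_tri k);
  tri_tri : forall (g h k : G) (gh : p h = Phi g) (hk : p k = Phi h)
      (g_hk : p (tri h k hk) = Phi g)
      (gh_k : p k = Phi (mul_op B p_tri g h gh)),
    tri g (tri h k hk) g_hk = tri (mul_op B p_tri g h gh) k gh_k;
  tri_bij : forall g : G, bijective (left_translation p_tri g)
}.
Arguments tri {G L p Phi B}.
Arguments p_tri {G L p Phi B}.

Record post_semiloopoid {G L : Type} (p Phi : G -> L) : Type :=
  PostSemiloopoid {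
    ps_bundle : group_bundle p;
    ps_structure : post_structure Phi (gb_groups ps_bundle)
  }.
Arguments ps_bundle {G L p Phi}.
Arguments ps_structure {G L p Phi}.

(* The first clause says that the units of the groups are the given loops at
   the vertices in the image of tgt; it is void at the other vertices, which
   have no loops. *)
Definition compatible {L : Type} {G : semiloopoid L}
    {B : fibre_groups (@src L G)} (P : post_structure tgt B) : Prop :=
  (forall (l : L) (u : G), unit_loop bullet l u -> sval (gone (B l)) = u) /\
  (forall (x y : G) (e : src y = tgt x),
     bullet x y e = mul_op B (p_tri P) x y e).

Definition compatible_post_semiloopoid {L : Type} (G : semiloopoid L) : Type :=
  {P : post_semiloopoid (@src L G) tgt | compatible (ps_structure P)}.

Definition compatible_post_structure {L : Type} (G : semiloopoid L) : Type :=
  {B : fibre_groups (@src L G) & {P : post_structure tgt B | compatible P}}.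

(* Equivalence of two kinds of data that both contain a family of groups on the
   fibres of p: a bijection that leaves these groups unchanged. *)
Definition equivalent_data {G L : Type} {p : G -> L} {X Y : Type}
    (groupsX : X -> fibre_groups p) (groupsY : Y -> fibre_groups p) : Prop :=
  exists (f : X -> Y) (g : Y -> X),
    [/\ cancel f g, cancel g f & forall a, groupsY (f a) = groupsX a].

(* Main.v *)
(** The two structures determine each other through
    [x |> y = x^-1 . (x bullet y)].  Under this substitution the skew brace law
    says that [x |> (.)] is a homomorphism, and associativity of [bullet] becomes
    axiom (5); axiom (1) holds because the skew brace law for the product [1 . 1]
    gives [x bullet 1 = x], which for the loop [x] at a vertex reads [1 = x].
    As [|>] is determined by the groups and by [bullet], both kinds of data are
    properties of the family of groups alone.
    Finally, [x |> (.)] is an isomorphism between the groups at the endpoints of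
    [x], so all the groups are isomorphic when the quiver is connected. *)

Require Import Defs.
From mathcomp Require Import ssreflect ssrfun ssrbool.
From Stdlib Require Import Relations ProofIrrelevance FunctionalExtensionality.

Lemma fibre_inj {G L : Type} {p : G -> L} {l : L} (x y : fibre p l) :
  sval x = sval y -> x = y.
Proof.
case: x y => [x ex] [y ey] /= exy; case: y / exy ey => ey.
by rewrite (proof_irrelevance _ ex ey).
Qed.

(* The proof [svalP] in [left_translation] is opaque, so this is not a
   computation. *)
Lemma left_translation_to_fibre {G L : Type} {p f : G -> L}
    {op : partial_op p f} (op_p : forall x y e, p (op x y e) = p x)
    (x y : G) (e : p y = f x) :
  left_translation op_p x (to_fibre y e) = to_fibre (op x y e) (op_p x y e).
Proof.
apply: fibre_inj => /=; congr op; exact: proof_irrelevance.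
Qed.

(** * Cancellation and isomorphism of groups *)

Section Groups.

Context {T : Type} (A : group_on T).

Lemma gmulK (x : T) : cancel (gmul A x) (gmul A (ginv A x)).
Proof. by move=> y; rewrite gmulA gmulVx gmul1x. Qed.

Lemma gmulVK (x : T) : cancel (gmul A (ginv A x)) (gmul A x).
Proof. by move=> y; rewrite gmulA gmulxV gmul1x. Qed.

Lemma ginv_bij (x : T) : bijective (gmul A (ginv A x)).
Proof. by exists (gmul A x); [apply: gmulVK | apply: gmulK]. Qed.

Lemma isomorphic_refl : isomorphic A A.
Proof. by exists id => //; exists id. Qed.

Lemma isomorphic_sym {U : Type} (C : group_on U) :
  isomorphic A C -> isomorphic C A.
Proof.
case=> phi [psi phiK psiK] phiM; exists psi; first by exists phi.
by move=> x y; rewrite -{1}(psiK x) -{1}(psiK y) -phiM phiK.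
Qed.

Lemma isomorphic_trans {U V : Type} (C : group_on U) (D : group_on V) :
  isomorphic A C -> isomorphic C D -> isomorphic A D.
Proof.
case=> phi phi_bij phiM [psi psi_bij psiM].
exists (psi \o phi); first exact: bij_comp.
by move=> x y; rewrite /= phiM psiM.
Qed.

End Groups.

(** When the groups determine the whole structure on both sides, two maps that keep the groups are
    automatically mutually inverse, so no round trip has to be computed. *)
Lemma equivalent_data_of_injective {G L : Type} {p : G -> L} {X Y : Type}
    (groupsX : X -> fibre_groups p) (groupsY : Y -> fibre_groups p)
    (f : X -> Y) (g : Y -> X) :
    injective groupsX -> injective groupsY ->
    (forall a, groupsY (f a) = groupsX a) ->
    (forall b, groupsX (g b) = groupsY b) ->
  equivalent_data groupsX groupsY.
Proof.
move=> injX injY fE gE; exists f, g; split=> // a.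
  by apply: injX; rewrite gE fE.
by apply: injY; rewrite fE gE.
Qed.

(** * From post-structures to skew braces *)

Section PostStructure.

Context {L : Type} {G : semiloopoid L} {B : fibre_groups (@src L G)}.

Lemma bullet_fibreE (P : post_structure tgt B) (x : G)
    (y : fibre src (tgt x)) : compatible P ->
  left_translation src_bullet x y =
  gmul (B (src x)) (in_own_fibre src x) (left_translation (p_tri P) x y).
Proof.
case: y => y e [_ bulE]; apply: fibre_inj.
by rewrite -/(to_fibre y e) !left_translation_to_fibre /= bulE.
Qed.

(** Cancelling x in x • y = x · (x |> y) recovers [tri] from the groups and [bullet]; all other
    fields are propositions. *)
Lemma compatible_post_structure_unique (P Q : post_structure tgt B) :
  compatible P -> compatible Q -> P = Q.
Proof.
move=> cP cQ; have tri_eq : tri P = tri Q.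
  apply: functional_extensionality_dep => x.
  apply: functional_extensionality_dep => y.
  apply: functional_extensionality_dep => e.
  have := bullet_fibreE P x (to_fibre y e) cP.
  rewrite (bullet_fibreE Q) // => eQP.
  have := can_inj (gmulK _ _) eQP; rewrite !left_translation_to_fibre.
  by move=> /(congr1 sval).
case: P Q tri_eq {cP cQ} => [t a1 a2 a3 a4 a5 a6] [t' b1 b2 b3 b4 b5 b6] /= tt'.
case: t' / tt' b1 b2 b3 b4 b5 b6 => b1 b2 b3 b4 b5 b6.
(* The types of the later axioms mention the proof of [p_tri], so this proof is identified before
   they are. *)
case: b2 / (proof_irrelevance _ a2 b2) b3 b4 b5 b6 => b3 b4 b5 b6.
rewrite (proof_irrelevance _ a1 b1) (proof_irrelevance _ a3 b3).
rewrite (proof_irrelevance _ a4 b4) (proof_irrelevance _ a5 b5).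
by rewrite (proof_irrelevance _ a6 b6).
Qed.

Lemma isomorphic_tgt_src (P : post_structure tgt B) (x : G) :
  isomorphic (B (tgt x)) (B (src x)).
Proof.
exists (left_translation (p_tri P) x); first exact: tri_bij.
exact: tri_mul.
Qed.

Lemma connected_pairwise_isomorphic (P : post_structure tgt B) :
  connected G -> pairwise_isomorphic B.
Proof.
move=> conG l m; elim: (conG l m) => {l m}.
- move=> _ _ [x <- <-]; exact/isomorphic_sym/(isomorphic_tgt_src P).
- by move=> l; apply: isomorphic_refl.
- by move=> l m _; apply: isomorphic_sym.
- by move=> l m n _ lm _; apply: isomorphic_trans.
Qed.

Definition skew_brace_of_post (P : post_structure tgt B) (cP : compatible P) :
  skew_brace G.
Proof.
exists B => x y z mul inv x_bullet; rewrite /x_bullet !(bullet_fibreE P) //.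
(* On the right, x^-1 cancels the factor x of x • z = x · (x |> z). *)
by rewrite tri_mul /mul -!gmulA gmulK.
Defined.

End PostStructure.

(** * From skew braces to post-structures *)

Section SkewBrace.

Context {L : Type} {G : semiloopoid L} (S : skew_brace G).
Let B := sb_groups S.

Definition sb_tri : partial_op (@src L G) tgt := fun x y e =>
  sval (gmul (B (src x)) (ginv (B (src x)) (in_own_fibre src x))
          (left_translation src_bullet x (to_fibre y e))).

Lemma src_sb_tri x y e : src (sb_tri x y e) = src x.
Proof. by rewrite /sb_tri; case: (gmul _ _ _). Qed.

Lemma sb_tri_fibreE (x : G) (y : fibre src (tgt x)) :
  left_translation src_sb_tri x y =
  gmul (B (src x)) (ginv (B (src x)) (in_own_fibre src x))
    (left_translation src_bullet x y).
Proof.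
case: y => y e; apply: fibre_inj.
by rewrite -/(to_fibre y e) !left_translation_to_fibre /= /sb_tri
  left_translation_to_fibre.
Qed.

(* The source of [h] is only propositionally equal to [l], the vertex at which
   axiom (5) takes the product. *)
Lemma sb_tri_transportE (l : L) (h : fibre src l) (k : G)
    (e : src k = tgt (sval h)) (e1 : src (sb_tri (sval h) k e) = l)
    (e2 : src (bullet (sval h) k e) = l) :
  to_fibre (sb_tri (sval h) k e) e1 =
  gmul (B l) (ginv (B l) h) (to_fibre (bullet (sval h) k e) e2).
Proof.
case: h e e1 e2 => h hl /=; case: l / hl => e e1 e2.
apply: fibre_inj; rewrite /= /sb_tri left_translation_to_fibre.
by rewrite (proof_irrelevance _ (src_bullet h k _) e2).
Qed.

Lemma sb_tri_mul (x : G) :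
  {morph left_translation src_sb_tri x :
     y z / gmul (B (tgt x)) y z >-> gmul (B (src x)) y z}.
Proof. by move=> y z; rewrite !sb_tri_fibreE sb_distr -/B !gmulA. Qed.

Lemma sb_mul_opE (x y : G) (e : src y = tgt x) :
  mul_op B src_sb_tri x y e = bullet x y e.
Proof.
rewrite /mul_op -left_translation_to_fibre sb_tri_fibreE gmulVK.
by rewrite left_translation_to_fibre.
Qed.

(** With w = x • 1, the skew brace law for 1 · 1 reads w = w · x^-1 · w; cancelling w leaves x^-1 ·
    w = 1. *)
Lemma bullet_gone (x : G) :
  left_translation src_bullet x (gone (B (tgt x))) = in_own_fibre src x.
Proof.
have := sb_distr _ S x (gone (B (tgt x))) (gone (B (tgt x))).
rewrite /= -/B gmul1x; set w := left_translation _ _ _ => wE.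
rewrite -[LHS](gmulVK (B (src x)) (in_own_fibre src x)).
rewrite -[RHS](gmulx1 _ (B (src x))); congr gmul.
by apply: (can_inj (gmulK (B (src x)) w)); rewrite gmulA -wE gmulx1.
Qed.

(** The product u • 1 equals [u] by [bullet_gone], and equals 1 because [u] is a left unit. *)
Lemma gone_unit_loop (l : L) (u : G) :
  unit_loop bullet l u -> sval (gone (B l)) = u.
Proof.
case=> _ tu _; case: l / tu => ubul.
have := bullet_gone u; case: (gone _) => o eo.
by rewrite left_translation_to_fibre => /(congr1 sval) /=; rewrite ubul.
Qed.

(** Multiplied on the left by g • h, both sides become g • (h • k): the right one by associativity,
    the left one because g • h = g · (g |> h) and g |> (.) is a homomorphism. *)
Lemma sb_tri_tri (g h k : G) (gh : src h = tgt g) (hk : src k = tgt h)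
    (g_hk : src (sb_tri h k hk) = tgt g)
    (gh_k : src k = tgt (mul_op B src_sb_tri g h gh)) :
  sb_tri g (sb_tri h k hk) g_hk = sb_tri (mul_op B src_sb_tri g h gh) k gh_k.
Proof.
move: gh_k; rewrite sb_mul_opE => gh_k.
have hk_src : src (bullet h k hk) = tgt g by rewrite src_bullet.
have ghk_src : src (bullet (bullet g h gh) k gh_k) = src g.
  by rewrite !src_bullet.
have gh_k_src : src (sb_tri (bullet g h gh) k gh_k) = src g.
  by rewrite src_sb_tri src_bullet.
(* The source of g • h equals [src g] only propositionally; [gh'] places the product in the fibre
   over [src g], where both sides are compared. *)
pose gh' : fibre src (src g) := to_fibre (bullet g h gh) (src_bullet g h gh).
have rhsE := sb_tri_transportE (src g) gh' k gh_k gh_k_src ghk_src.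
have lhsE := sb_tri_transportE _ (to_fibre h gh) k hk g_hk hk_src.
have ghkE : to_fibre (bullet (sval gh') k gh_k) ghk_src =
    left_translation src_bullet g (to_fibre (bullet h k hk) hk_src).
  by rewrite left_translation_to_fibre; apply/fibre_inj/esym/bulletA.
suff: left_translation src_sb_tri g (to_fibre (sb_tri h k hk) g_hk)
    = to_fibre (sb_tri (bullet g h gh) k gh_k) gh_k_src.
  by rewrite left_translation_to_fibre => /(congr1 sval).
rewrite rhsE ghkE; apply: (can_inj (gmulK (B (src g)) gh')); rewrite gmulVK.
(* Writing [gh'] as g · (g |> h) lets [sb_tri_mul] merge the factors g |> h and g |> (h |> k) into g
   |> (h · (h |> k)), that is, g |> (h • k). *)
rewrite -(gmulVK (B (src g)) (in_own_fibre src g) gh').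
rewrite /gh' -left_translation_to_fibre -sb_tri_fibreE.
by rewrite -gmulA -sb_tri_mul lhsE gmulVK sb_tri_fibreE gmulVK.
Qed.

Lemma sb_Phi_one (l : L) :
  (exists g : G, tgt g = l) -> tgt (sval (gone (B l))) = l.
Proof.
by move=> /(bullet_unit _ G)[u ul]; rewrite (gone_unit_loop l u ul); case: ul.
Qed.

Lemma sb_tri_bij (x : G) : bijective (left_translation src_sb_tri x).
Proof.
apply: (eq_bij _ (fun y => esym (sb_tri_fibreE x y))).
exact: bij_comp (ginv_bij _ _) (bullet_bij _ _ x).
Qed.

Definition post_of_skew_brace : post_structure (@tgt L G) B.
Proof.
exists sb_tri src_sb_tri; first exact: sb_Phi_one.
- by move=> g h e; rewrite sb_mul_opE tgt_bullet.
- exact: sb_tri_mul.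
- exact: sb_tri_tri.
- exact: sb_tri_bij.
Defined.

Lemma post_of_skew_brace_compatible : compatible post_of_skew_brace.
Proof.
by split=> [l u|x y e]; [apply: gone_unit_loop | rewrite sb_mul_opE].
Qed.

End SkewBrace.

(** * The groups determine each kind of data *)

Section Injectivity.

Context {L : Type} {G : semiloopoid L}.

Lemma sb_groups_inj : injective (fun S : skew_brace G => sb_groups S).
Proof.
case=> [B d] [B' d'] /= eB; case: B' / eB d' => d'.
by rewrite (proof_irrelevance _ d d').
Qed.

Lemma compatible_post_structure_inj :
  injective (fun P : compatible_post_structure G => projT1 P).
Proof.
case=> [B [P cP]] [B' [P' cP']] /= eB; case: B' / eB P' cP' => P' cP'.
have ePP' := compatible_post_structure_unique _ _ cP cP'.
case: P' / ePP' cP' => cP'.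
by rewrite (proof_irrelevance _ cP cP').
Qed.

Lemma compatible_post_semiloopoid_inj :
  injective
    (fun P : compatible_post_semiloopoid G => gb_groups (ps_bundle (sval P))).
Proof.
case=> [[[B i] P] cP] [[[B' i'] P'] cP'] /= eB.
case: B' / eB i' P' cP' => i' /= P' cP'.
have ePP' := compatible_post_structure_unique _ _ cP cP'.
case: P' / ePP' cP' => cP'.
case: i' / (proof_irrelevance _ i i') cP' => cP'.
by rewrite (proof_irrelevance _ cP cP').
Qed.

Lemma isomorphic_skew_brace_inj :
  injective (fun S : {S : skew_brace G | pairwise_isomorphic (sb_groups S)} =>
               sb_groups (sval S)).
Proof.
case=> [S i] [S' i'] /= /sb_groups_inj eS; case: S' / eS i' => i'.
by rewrite (proof_irrelevance _ i i').
Qed.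

End Injectivity.

Definition post_semiloopoid_of_skew_brace {L : Type} {G : semiloopoid L}
    (S : skew_brace G) (iso : pairwise_isomorphic (sb_groups S)) :
    compatible_post_semiloopoid G :=
  exist _ (PostSemiloopoid _ _ _ _ (GroupBundle _ _ _ _ iso)
             (post_of_skew_brace S))
    (post_of_skew_brace_compatible S).

(** A disjoint union of skew braces with non-isomorphic groups is a skew brace but yields no group
    bundle. Hence the three versions: connected quivers, isomorphic groups imposed on the skew
    braces, or isomorphy dropped from the post-semiloopoids. *)
Theorem theorem3p8 (L : Type) (G : semiloopoid L) :
  [/\ connected G ->
      equivalent_data
        (fun B : skew_brace G => sb_groups B)
        (fun P : compatible_post_semiloopoid G =>
           gb_groups (ps_bundle (sval P))),
      equivalent_data
        (fun B : {B : skew_brace G | pairwise_isomorphic (sb_groups B)} =>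
           sb_groups (sval B))
        (fun P : compatible_post_semiloopoid G =>
           gb_groups (ps_bundle (sval P)))
    & equivalent_data
        (fun B : skew_brace G => sb_groups B)
        (fun P : compatible_post_structure G => projT1 P)].
Proof.
split.
(* The post-structure built from [S] itself provides the isomorphisms that turn its groups into a
   bundle. *)
- move=> conG; apply: (equivalent_data_of_injective _ _
    (fun S => post_semiloopoid_of_skew_brace S
       (connected_pairwise_isomorphic (post_of_skew_brace S) conG))
    (fun P => skew_brace_of_post _ (svalP P)) sb_groups_inj
    compatible_post_semiloopoid_inj) => //.
- apply: (equivalent_data_of_injective _ _
    (fun S => post_semiloopoid_of_skew_brace _ (svalP S))
    (fun P => exist _ (skew_brace_of_post _ (svalP P))
       (gb_iso (ps_bundle (sval P))))
    isomorphic_skew_brace_inj compatible_post_semiloopoid_inj) => //.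
- apply: (equivalent_data_of_injective _ _
    (fun S => existT _ (sb_groups S)
       (exist _ (post_of_skew_brace S) (post_of_skew_brace_compatible S)))
    (fun P => skew_brace_of_post _ (svalP (projT2 P)))
    sb_groups_inj compatible_post_structure_inj) => //.
Qed.
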